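(* Let $\gamma:I\to\mathbb{R}^4$ be a non-degenerate Lagrangian curve. Then its osculating curve $\delta_\gamma:I\to\Lambda^2_+$, $\delta_\gamma(t)=[\gamma'(t)\wedge\gamma''(t)]$, is a null curve of $\Lambda^2_+$.
   Context: On $\mathbb{R}^4$ let $\Lambda(X,Y)=x_1y_3+x_2y_4-x_3y_1-x_4y_2$. A smooth curve $\gamma:I\to\mathbb{R}^4$ is Lagrangian if $\gamma',\gamma''$ are linearly independent and $\Lambda(\gamma',\gamma'')=0$ everywhere; it is non-degenerate if $\Lambda(\gamma'',\gamma''')\ne0$ everywhere. $\Lambda^2_+$ is the manifold of oriented Lagrangian planes of $\mathbb{R}^4$ (oriented 2-dimensional linear subspaces on which $\Lambda$ vanishes); $[v\wedge w]$ denotes the plane spanned by $v,w$ with the orientation of the basis $(v,w)$. $\mathrm{Sp}(4,\mathbb{R})$ is identified with the bases $\mathbf{E}=(E_1,\dots,E_4)$ satisfying $\Lambda(E_1,E_3)=\Lambda(E_2,E_4)=1$ and $\Lambda(E_a,E_b)=0$ for the other $a<b$. The map $\pi_\Lambda:\mathbf{E}\mapsto[E_1\wedge E_2]$ makes $\mathrm{Sp}(4,\mathbb{R})$ a principal bundle over $\Lambda^2_+$. Let $\eta^i_j=\Lambda(E_i,dE_j)$, $i,j=1,2$, which are left-invariant 1-forms on $\mathrm{Sp}(4,\mathbb{R})$ symmetric in $i,j$; they span the semi-basic forms of $\pi_\Lambda$. The quadratic form $g=-\eta^1_1\eta^2_2+(\eta^2_1)^2$ is well defined on $\Lambda^2_+$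 up to a positive multiple and defines a conformal structure of signature $(2,1)$. A smooth immersed curve $\delta:I\to\Lambda^2_+$ is null if its tangent vectors are isotropic for this conformal structure. Equivalently, for any smooth lift $\mathbf{E}:I\to\mathrm{Sp}(4,\mathbb{R})$ of $\delta$, writing $\mathbf{E}^*\eta^i_j=c^i_jdt$, one has $c^1_1c^2_2-(c^2_1)^2=0$ and $(c^1_1,c^2_2,c^2_1)\neq(0,0,0)$ everywhere. *)

(* Defs.v *)
From HB Require Import structures.
From mathcomp Require Import all_boot all_order all_algebra.
From mathcomp Require Import all_classical all_reals all_analysis.

Set Implicit Arguments.
Unset Strict Implicit.
Unset Printing Implicit Defensive.

Import Order.TTheory GRing.Theory Num.Theory.
Import numFieldNormedType.Exports.

Local Open Scope classical_set_scope.
Local Open Scope ring_scope.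

(* Only used for open J, where the iterated derivatives on J depend on the
   values of f on J alone; outside J the total function f is arbitrary. *)
Definition smooth_on (R : realType) (V : normedModType R)
    (J : set R) (f : R -> V) : Prop :=
  forall (n : nat) (t : R), J t -> derivable (derive1n n f) t 1.

(* Coordinates are numbered from 0. *)
Definition Lam (R : realType) (X Y : 'rV[R]_4) : R :=
  X 0 0 * Y 0 2 + X 0 1 * Y 0 3 - X 0 2 * Y 0 0 - X 0 3 * Y 0 1.

Definition lagrangian_curve (R : realType) (I : set R)
    (gamma : R -> 'rV[R]_4) : Prop :=
  smooth_on I gamma /\
  forall t, I t ->
    free [:: derive1 gamma t; derive1n 2 gamma t] /\
    Lam (derive1 gamma t) (derive1n 2 gamma t) = 0.

Definition nondegenerate_curve (R : realType) (I : set R)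
    (gamma : R -> 'rV[R]_4) : Prop :=
  forall t, I t -> Lam (derive1n 2 gamma t) (derive1n 3 gamma t) != 0.

(* An oriented plane is encoded as the set of its positively oriented bases. *)
Definition oriented_plane (R : realType) := set ('rV[R]_4 * 'rV[R]_4).

(* The orientation class of (v, w): its orbit under GL+(2). *)
Definition oplane (R : realType) (v w : 'rV[R]_4) : oriented_plane R :=
  [set p | exists a b c d : R,
     [/\ 0 < a * d - b * c, p.1 = a *: v + b *: w & p.2 = c *: v + d *: w]].

Definition Lambda2p (R : realType) : set (oriented_plane R) :=
  [set P | exists v w : 'rV[R]_4,
     [/\ free [:: v; w], Lam v w = 0 & P = oplane v w]].

(* The basis (E_1, ..., E_4) is stored as the rows 0, ..., 3 of a matrix. *)
Definition Sp4 (R : realType) : set 'M[R]_4 :=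
  [set E | [/\ E \in unitmx,
    Lam (row 0 E) (row 2 E) = 1 /\ Lam (row 1 E) (row 3 E) = 1,
    Lam (row 0 E) (row 1 E) = 0 /\ Lam (row 0 E) (row 3 E) = 0
  & Lam (row 1 E) (row 2 E) = 0 /\ Lam (row 2 E) (row 3 E) = 0]].

Definition piLam (R : realType) (E : 'M[R]_4) : oriented_plane R :=
  oplane (row 0 E) (row 1 E).

(* The value at E, on the tangent vector Xi, of the form Lam(E_i, dE_j);
   it is used for i, j in {0, 1}. *)
Definition eta (R : realType) (i j : 'I_4) (E Xi : 'M[R]_4) : R :=
  Lam (row i E) (row j Xi).

Definition gconf (R : realType) (E Xi : 'M[R]_4) : R :=
  - (eta 0 0 E Xi * eta 1 1 E Xi) + eta 1 0 E Xi ^+ 2.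

Definition lift_on (R : realType) (J : set R) (delta : R -> oriented_plane R)
    (E : R -> 'M[R]_4) : Prop :=
  smooth_on J E /\ forall t, J t -> Sp4 (E t) /\ piLam (E t) = delta t.

(* Lambda2p carries the manifold structure of the base of the principal bundle
   piLam, i.e. the unique one for which piLam is a surjective submersion.  Its
   smooth curves are those which locally have a smooth lift to Sp4. *)
Definition smooth_curve (R : realType) (I : set R)
    (delta : R -> oriented_plane R) : Prop :=
  (forall t, I t -> Lambda2p (delta t)) /\
  forall t, I t -> exists (J : set R) (E : R -> 'M[R]_4),
    [/\ open J, J t, J `<=` I & lift_on J delta E].

(* The kernel of d(piLam) at E: the vectors tangent to the fibre through E. *)
Definition vertical (R : realType) (E Xi : 'M[R]_4) : Prop :=
  exists (J : set R) (c : R -> 'M[R]_4),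
    [/\ open J, J 0, lift_on J (fun=> piLam E) c, c 0 = E & derive1 c 0 = Xi].

(* The tangent vector delta'(t) is d(piLam)(E'(t)) for any smooth lift E of
   delta around t; it vanishes iff E'(t) is vertical. *)
Definition immersed_curve (R : realType) (I : set R)
    (delta : R -> oriented_plane R) : Prop :=
  forall (J : set R) (E : R -> 'M[R]_4), open J -> J `<=` I ->
    lift_on J delta E -> forall t, J t -> ~ vertical (E t) (derive1 E t).

(* gconf is semi-basic, so its value on E'(t) is the value on delta'(t) of the
   representative at E(t) of the conformal structure of Lambda2p. *)
Definition isotropic_curve (R : realType) (I : set R)
    (delta : R -> oriented_plane R) : Prop :=
  forall (J : set R) (E : R -> 'M[R]_4), open J -> J `<=` I ->
    lift_on J delta E -> forall t, J t -> gconf (E t) (derive1 E t) = 0.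

Definition null_curve (R : realType) (I : set R)
    (delta : R -> oriented_plane R) : Prop :=
  [/\ smooth_curve I delta, immersed_curve I delta & isotropic_curve I delta].

Definition osculating (R : realType) (gamma : R -> 'rV[R]_4) (t : R) :
    oriented_plane R :=
  oplane (derive1 gamma t) (derive1n 2 gamma t).

(* Main.v *)
Require Import Defs.
From mathcomp Require Import all_boot all_order all_algebra.
From mathcomp Require Import all_classical all_reals all_analysis.
From mathcomp Require Import ring.
Import numFieldNormedType.Exports.

(** Write g1, g2, g3, g4 for the first four derivatives of the curve gamma and
    lambda = Lam (g2, g3), which vanishes nowhere.  Differentiating
    Lam (g1, g2) = 0 gives Lam (g1, g3) = 0, and differentiating once more
    gives Lam (g1, g4) = - lambda.  So g1, g2, g3, g4 is a basis whose
    Lam-products are known up to Lam (g2, g4) and Lam (g3, g4), and a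
    triangular correction of g3 and g4, with coefficients rational in these
    products and with denominators powers of lambda, completes g1, g2 to a
    smooth symplectic frame (Sp4_osculating_frame, osculating_lift).  Hence the
    osculating curve has a smooth lift on the whole of I.

    Now take any smooth lift E.  Its first two rows stay in the plane of g1 and
    g2, so E_i = a_i g1 + b_i g2 at each time.  The relations
    Lam (g1, E_j) = Lam (g2, E_j) = 0 hold identically, and their derivatives
    give Lam (g1, E_j') = 0 and Lam (g2, E_j') = b_j lambda, without any
    regularity of the coefficients a_j and b_j (derive1_in_osculating).  Thus
    eta^i_j takes the value b_i b_j lambda on E' (osculating_eta): the velocity
    of the osculating curve is a symmetric matrix of rank one.  Its determinant
    vanishes, which is isotropy.  It is itself nonzero, since (b_0, b_1) is a
    column of an invertible matrix.  As the forms eta vanish on the vectors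
    tangent to the fibres (vertical_eta), E' is not vertical, which is
    immersion. *)

Set Implicit Arguments.
Unset Strict Implicit.
Unset Printing Implicit Defensive.

Import Order.TTheory GRing.Theory Num.Theory.

Local Open Scope classical_set_scope.
Local Open Scope ring_scope.

(** * Calculus of smooth curves on an open set *)

(** The recursion differentiates first, so that a Leibniz formula for the first
    derivative lets an induction on the order, over all functions at once,
    replace the formulas for higher derivatives. *)
Fixpoint derivable_upto (R : realType) (V : normedModType R) (J : set R)
    (n : nat) (f : R -> V) : Prop :=
  if n is n'.+1 then
    (forall t, J t -> derivable f t 1) /\ derivable_upto J n' (derive1 f)
  else True.

Lemma smooth_onP (R : realType) (V : normedModType R) (J : set R)
    (f : R -> V) :
  smooth_on J f <-> forall n, derivable_upto J n f.
Proof.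
split=> [fJ n|fJ n].
- elim: n f fJ => [//|n IHn] f fJ /=; split; first exact: (fJ 0).
  by apply: IHn => k t Jt; rewrite -derive1Sn; exact: fJ.
- elim: n f fJ => [|n IHn] f fJ t Jt; first exact: (fJ 1).1.
  rewrite derive1Sn; apply: IHn => // k; exact: (fJ k.+1).2.
Qed.

Lemma smooth_derive1 (R : realType) (V : normedModType R) (J : set R)
    (f : R -> V) :
  smooth_on J f -> smooth_on J (derive1 f).
Proof. by move=> fJ n t Jt; rewrite -derive1Sn; exact: fJ. Qed.

Lemma smooth_cst (R : realType) (V : normedModType R) (J : set R) (a : V) :
  smooth_on J (cst a).
Proof.
apply/smooth_onP => n; elim: n a => [//|n IHn] a.
split=> [t _|]; first exact: derivable_cst.
have -> : derive1 (cst a) = cst 0 by apply/funext => t; exact: derive1_cst.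
exact: IHn.
Qed.

Section Smooth.
Context {R : realType} {J : set R} (J_open : open J).

Lemma near_open (t : R) (P : R -> Prop) :
  J t -> (forall s, J s -> P s) -> \forall s \near t, P s.
Proof.
move=> Jt JP; have : nbhs t J by exact: open_nbhs_nbhs.
exact: filterS.
Qed.

Lemma eq_on_derive1 (V : normedModType R) (f g : R -> V) (t : R) :
  J t -> (forall s, J s -> f s = g s) -> derive1 f t = derive1 g t.
Proof.
move=> Jt fg; rewrite !derive1E; apply: near_eq_derive.
exact: near_open.
Qed.

(** The formulas for the derivative of a product or an inverse hold on J only;
    this carries them through the higher derivatives, J being open. *)
Lemma derivable_upto_eq (V : normedModType R) (f g : R -> V) n :
  (forall t, J t -> f t = g t) ->
  derivable_upto J n f -> derivable_upto J n g.
Proof.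
elim: n f g => [//|n IHn] f g fg /= [df d2f]; split=> [t Jt|].
- apply: (@near_eq_derivable _ _ _ f); last exact: df.
  exact: near_open.
- by apply: IHn d2f => t Jt; exact: eq_on_derive1.
Qed.

Lemma derivable_uptoW (V : normedModType R) (f : R -> V) n :
  derivable_upto J n.+1 f -> derivable_upto J n f.
Proof.
by elim: n f => [//|n IHn] f [df d2f]; split=> //; exact: IHn.
Qed.

Lemma derivable_uptoD (V : normedModType R) (f g : R -> V) n :
  derivable_upto J n f -> derivable_upto J n g ->
  derivable_upto J n (fun t => f t + g t).
Proof.
elim: n f g => [//|n IHn] f g [df d2f] [dg d2g]; split=> [t Jt|].
- by apply: derivableD; [exact: df|exact: dg].
- apply: derivable_upto_eq (IHn _ _ d2f d2g) => t Jt.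
  by rewrite !derive1E deriveD//; [exact: df|exact: dg].
Qed.

Lemma derivable_uptoM (f g : R -> R) n :
  derivable_upto J n f -> derivable_upto J n g ->
  derivable_upto J n (fun t => f t * g t).
Proof.
elim: n f g => [//|n IHn] f g df dg; split=> [t Jt|].
- by apply: derivableM; [exact: df.1|exact: dg.1].
- apply: (@derivable_upto_eq _
    (fun t => derive1 f t * g t + f t * derive1 g t)).
    move=> t Jt; rewrite !derive1E deriveM; [|exact: df.1|exact: dg.1].
    by rewrite addrC; congr (_ + _); exact: mulrC.
  apply: derivable_uptoD.
  + by apply: IHn; [exact: df.2|exact: derivable_uptoW].
  + by apply: IHn; [exact: derivable_uptoW|exact: dg.2].
Qed.

Lemma derivable_uptoN (V : normedModType R) (f : R -> V) n :
  derivable_upto J n f -> derivable_upto J n (fun t => - f t).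
Proof.
elim: n f => [//|n IHn] f [df d2f]; split=> [t Jt|].
- by apply: derivableN; exact: df.
- apply: derivable_upto_eq (IHn _ d2f) => t Jt.
  by rewrite !derive1E deriveN//; exact: df.
Qed.

(** The derivative of 1/f is a product of f' and two factors 1/f, so 1/f
    is n.+1 times derivable as soon as f is and 1/f is n times derivable. *)
Lemma derivable_uptoV (f : R -> R) n : (forall t, J t -> f t != 0) ->
  derivable_upto J n f -> derivable_upto J n (fun t => (f t)^-1).
Proof.
move=> f0; elim: n => [//|n IHn] df; split=> [t Jt|].
- by apply: derivableV; [exact: f0|exact: df.1].
- have dV := IHn (derivable_uptoW df).
  apply: (@derivable_upto_eq _
    (fun t => - ((f t)^-1 * ((f t)^-1 * derive1 f t)))).
    move=> t Jt; rewrite !derive1E deriveV; [|exact: f0|exact: df.1].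
    by rewrite scaleNr; congr (- _); rewrite mulrA expr2 invfM.
  apply: derivable_uptoN; apply: derivable_uptoM => //.
  by apply: derivable_uptoM => //; exact: df.2.
Qed.

Lemma derivable_upto_mx m n (M : R -> 'M[R]_(m.+1, n.+1)) k :
  derivable_upto J k M <->
  forall i j, derivable_upto J k (fun t => M t i j).
Proof.
elim: k M => [//|k IHk] M; split=> [[dM d2M] i j|dM].
- split=> [t Jt|]; first exact: (derivable_mxP M t 1).1 (dM t Jt) i j.
  apply: derivable_upto_eq ((IHk _).1 d2M i j) => t Jt.
  by rewrite !derive1E derive_mx ?mxE//; exact: dM.
- have dMt t : J t -> derivable M t 1.
    by move=> Jt; apply/derivable_mxP => i j; exact: (dM i j).1.
  split=> //; apply/IHk => i j; apply: derivable_upto_eq (dM i j).2 => t Jt.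
  by rewrite !derive1E derive_mx ?mxE//; exact: dMt.
Qed.

Lemma eq_smooth (V : normedModType R) (f g : R -> V) :
  f =1 g -> smooth_on J f -> smooth_on J g.
Proof. by move=> /funext ->. Qed.

Lemma smoothD (V : normedModType R) (f g : R -> V) :
  smooth_on J f -> smooth_on J g -> smooth_on J (fun t => f t + g t).
Proof.
by move=> /smooth_onP fJ /smooth_onP gJ; apply/smooth_onP => n;
  exact: derivable_uptoD.
Qed.

Lemma smoothN (V : normedModType R) (f : R -> V) :
  smooth_on J f -> smooth_on J (fun t => - f t).
Proof.
by move=> /smooth_onP fJ; apply/smooth_onP => n; exact: derivable_uptoN.
Qed.

Lemma smoothM (f g : R -> R) :
  smooth_on J f -> smooth_on J g -> smooth_on J (fun t => f t * g t).
Proof.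
by move=> /smooth_onP fJ /smooth_onP gJ; apply/smooth_onP => n;
  exact: derivable_uptoM.
Qed.

Lemma smoothV (f : R -> R) : (forall t, J t -> f t != 0) ->
  smooth_on J f -> smooth_on J (fun t => (f t)^-1).
Proof.
by move=> f0 /smooth_onP fJ; apply/smooth_onP => n; exact: derivable_uptoV.
Qed.

Lemma smooth_mx m n (M : R -> 'M[R]_(m.+1, n.+1)) :
  smooth_on J M <-> forall i j, smooth_on J (fun t => M t i j).
Proof.
split=> [/smooth_onP MJ i j|MJ].
- by apply/smooth_onP => k; exact: (derivable_upto_mx M k).1 (MJ k) i j.
- by apply/smooth_onP => k; apply/derivable_upto_mx => i j;
    exact: (smooth_onP _ _).1 (MJ i j) k.
Qed.

Lemma smooth_row m n (M : R -> 'M[R]_(m.+1, n.+1)) i :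
  smooth_on J M -> smooth_on J (fun t => row i (M t)).
Proof.
move=> /smooth_mx MJ; apply/smooth_mx => k j.
by apply: eq_smooth (MJ i j) => t; rewrite mxE.
Qed.

Lemma smoothZ (a : R -> R) n (X : R -> 'rV[R]_n.+1) :
  smooth_on J a -> smooth_on J X -> smooth_on J (fun t => a t *: X t).
Proof.
move=> aJ /smooth_mx XJ; apply/smooth_mx => i j.
by apply: eq_smooth (smoothM aJ (XJ i j)) => t; rewrite mxE.
Qed.

Lemma smooth_Lam (X Y : R -> 'rV[R]_4) :
  smooth_on J X -> smooth_on J Y -> smooth_on J (fun t => Lam (X t) (Y t)).
Proof.
move=> /smooth_mx XJ /smooth_mx YJ.
have XY i j : smooth_on J (fun t => X t 0 i * Y t 0 j) by exact: smoothM.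
by apply: smoothD; [apply: smoothD; [exact: smoothD|exact: smoothN]|
  exact: smoothN].
Qed.

Lemma derive1_coord m n (M : R -> 'M[R]_(m.+1, n.+1)) t i j :
  derivable M t 1 -> derive1 (fun s => M s i j) t = derive1 M t i j.
Proof. by move=> dM; rewrite !derive1E derive_mx// mxE. Qed.

Lemma derive1_Lam (X Y : R -> 'rV[R]_4) t :
  derivable X t 1 -> derivable Y t 1 ->
  derive1 (fun s => Lam (X s) (Y s)) t =
  Lam (derive1 X t) (Y t) + Lam (X t) (derive1 Y t).
Proof.
move=> dX dY.
have dXi i : derivable (fun s => X s 0 i) t 1.
  exact: (derivable_mxP X t 1).1 dX 0 i.
have dYi i : derivable (fun s => Y s 0 i) t 1.
  exact: (derivable_mxP Y t 1).1 dY 0 i.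
pose p i j s := X s 0 i * Y s 0 j.
have dp i j : is_derive t 1 (p i j)
    (derive1 X t 0 i * Y t 0 j + X t 0 i * derive1 Y t 0 j).
  apply: DeriveDef; first exact: derivableM.
  rewrite (deriveM (dXi i) (dYi j)) -!derive1E !derive1_coord//.
  by rewrite addrC; congr (_ + _); exact: mulrC.
rewrite derive1E.
have -> : (fun s => Lam (X s) (Y s)) = p 0 2 + p 1 3 - p 2 0 - p 3 1 by [].
move: (p) dp => {}p dp.
have [_ ->] := is_deriveB
  (is_deriveB (is_deriveD (dp 0 2) (dp 1 3)) (dp 2 0)) (dp 3 1).
by rewrite /Lam; move: (derive1 X t) (derive1 Y t) (X t) (Y t) => *; ring.
Qed.

Lemma derive1_row m n (M : R -> 'M[R]_(m.+1, n.+1)) t i :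
  derivable M t 1 -> derive1 (fun s => row i (M s)) t = row i (derive1 M t).
Proof.
move=> dM; have dMi : derivable (fun s => row i (M s)) t 1.
  apply/derivable_mxP => k j.
  suff -> : (fun s => row i (M s) k j) = (fun s => M s i j).
    exact: (derivable_mxP M t 1).1 dM i j.
  by apply/funext => s; rewrite mxE.
apply/rowP => j; rewrite mxE -(derive1_coord 0 j dMi) -(derive1_coord i j dM).
by congr (derive1 _ t); apply/funext => s; rewrite mxE.
Qed.

(** Every relation between the derivatives of gamma, and every value of the
    forms eta, comes from differentiating a relation Lam (X, Y) = 0 that holds
    on an open set. *)
Lemma Lam_eq0_derive1 (X Y : R -> 'rV[R]_4) t :
  smooth_on J X -> smooth_on J Y ->
  (forall s, J s -> Lam (X s) (Y s) = 0) -> J t ->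
  Lam (derive1 X t) (Y t) = - Lam (X t) (derive1 Y t).
Proof.
move=> XJ YJ XY Jt; apply/eqP; rewrite -addr_eq0 -derive1_Lam.
- by rewrite (eq_on_derive1 (g := cst 0) Jt XY) derive1_cst.
- exact: (XJ 0).
- exact: (YJ 0).
Qed.

End Smooth.

(** * Symplectic linear algebra *)

Lemma LamC (R : realType) (X Y : 'rV[R]_4) : Lam X Y = - Lam Y X.
Proof. by rewrite /Lam; ring. Qed.

Lemma Lamxx (R : realType) (X : 'rV[R]_4) : Lam X X = 0.
Proof. by rewrite /Lam; ring. Qed.

Lemma Lam0l (R : realType) (X : 'rV[R]_4) : Lam 0 X = 0.
Proof. by rewrite /Lam !mxE; ring. Qed.

Lemma LamDl (R : realType) (X Y Z : 'rV[R]_4) :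
  Lam (X + Y) Z = Lam X Z + Lam Y Z.
Proof. by rewrite /Lam !mxE; ring. Qed.

Lemma LamZl (R : realType) (a : R) (X Y : 'rV[R]_4) :
  Lam (a *: X) Y = a * Lam X Y.
Proof. by rewrite /Lam !mxE; ring. Qed.

Lemma LamDr (R : realType) (X Y Z : 'rV[R]_4) :
  Lam X (Y + Z) = Lam X Y + Lam X Z.
Proof. by rewrite LamC LamDl opprD -!(LamC X). Qed.

Lemma LamZr (R : realType) (a : R) (X Y : 'rV[R]_4) :
  Lam X (a *: Y) = a * Lam X Y.
Proof. by rewrite LamC LamZl -mulrN -LamC. Qed.

Lemma Lam_combr (R : realType) (a b : R) (X v w : 'rV[R]_4) :
  Lam X (a *: v + b *: w) = a * Lam X v + b * Lam X w.
Proof. by rewrite LamDr !LamZr. Qed.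

Definition frame (R : realType) (e0 e1 e2 e3 : 'rV[R]_4) : 'M[R]_4 :=
  \matrix_(i < 4) nth 0 [:: e0; e1; e2; e3] i.

(** If a combination of the rows vanishes, pairing it with each row isolates
    each coefficient in turn. *)
Lemma symplectic_unitmx (R : realType) (E : 'M[R]_4) :
  Lam (row 0 E) (row 2 E) = 1 /\ Lam (row 1 E) (row 3 E) = 1 ->
  Lam (row 0 E) (row 1 E) = 0 /\ Lam (row 0 E) (row 3 E) = 0 ->
  Lam (row 1 E) (row 2 E) = 0 /\ Lam (row 2 E) (row 3 E) = 0 ->
  E \in unitmx.
Proof.
move=> [h02 h13] [h01 h03] [h12 h23].
rewrite -row_free_unit; apply: inj_row_free => u uE.
have {}uE : u 0 0 *: row 0 E + u 0 1 *: row 1 E + u 0 2 *: row 2 E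
    + u 0 3 *: row 3 E = 0.
  rewrite -[RHS]uE mulmx_sum_row !big_ord_recl big_ord0 addr0 !addrA.
  by do !congr (_ + _); congr (u 0 _ *: row _ E); exact: val_inj.
have uL X : u 0 0 * Lam (row 0 E) X + u 0 1 * Lam (row 1 E) X
    + u 0 2 * Lam (row 2 E) X + u 0 3 * Lam (row 3 E) X = 0.
  by rewrite -!LamZl -!LamDl uE Lam0l.
have u0 : u 0 0 = 0.
  move: (uL (row 2 E)); rewrite h02 h12 Lamxx (LamC (row 3 E)) h23.
  by rewrite oppr0 !mulr0 !addr0 mulr1.
have u1 : u 0 1 = 0.
  move: (uL (row 3 E)); rewrite h03 h13 Lamxx h23.
  by rewrite !mulr0 !addr0 mulr1 add0r.
have u2 : u 0 2 = 0.
  move: (uL (row 0 E)); rewrite u0 u1 !mul0r !add0r (LamC (row 3 E)) h03.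
  by rewrite (LamC _ (row 0 E)) h02 oppr0 mulr0 addr0 mulrN1 => /eqP;
    rewrite oppr_eq0 => /eqP.
have u3 : u 0 3 = 0.
  move: (uL (row 1 E)); rewrite u0 u1 u2 !mul0r !add0r (LamC _ (row 1 E)) h13.
  by rewrite mulrN1 => /eqP; rewrite oppr_eq0 => /eqP.
apply/rowP => -[[|[|[|[|//]]]] ilt]; rewrite mxE.
- by rewrite -[RHS]u0; congr (u 0 _); exact: val_inj.
- by rewrite -[RHS]u1; congr (u 0 _); exact: val_inj.
- by rewrite -[RHS]u2; congr (u 0 _); exact: val_inj.
- by rewrite -[RHS]u3; congr (u 0 _); exact: val_inj.
Qed.

(** The last vector must be orthogonal to g1, so it is g3 normalised against g2.
    In the third one, the multiple of g4 normalises the product with g1, the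
    multiple of g3 makes it orthogonal to g2 without affecting g1, and the
    multiple of g2 makes it orthogonal to the last vector without affecting
    g1 and g2. *)
Lemma Sp4_osculating_frame (R : realType) (g1 g2 g3 g4 : 'rV[R]_4) :
  Lam g1 g2 = 0 -> Lam g1 g3 = 0 -> Lam g1 g4 = - Lam g2 g3 ->
  Lam g2 g3 != 0 ->
  Sp4 (frame g1 g2
    (- (Lam g2 g3)^-1 *: g4
      + Lam g2 g4 * ((Lam g2 g3)^-1 * (Lam g2 g3)^-1) *: g3
      + Lam g4 g3 * ((Lam g2 g3)^-1 * (Lam g2 g3)^-1) *: g2)
    ((Lam g2 g3)^-1 *: g3)).
Proof.
move=> h12 h13 h14 l0; set e2 := (X in frame _ _ X _); set e3 := _ *: g3.
set E := frame _ _ _ _.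
have r0 : row 0 E = g1 by exact: rowK.
have r1 : row 1 E = g2 by exact: rowK.
have r2 : row 2 E = e2 by exact: rowK.
have r3 : row 3 E = e3 by exact: rowK.
have h02 : Lam g1 e2 = 1 by rewrite /e2 !(LamDr, LamZr) h12 h13 h14; field.
have h13' : Lam g2 e3 = 1 by rewrite /e3 LamZr mulVf.
have h03 : Lam g1 e3 = 0 by rewrite /e3 LamZr h13 mulr0.
have h12' : Lam g2 e2 = 0 by rewrite /e2 !(LamDr, LamZr) Lamxx; field.
have h23 : Lam e2 e3 = 0.
  by rewrite /e2 /e3 LamZr !(LamDl, LamZl) Lamxx; field.
have gram1 := conj h02 h13'; have gram2 := conj h12 h03.
have gram3 := conj h12' h23.
by split; [apply: symplectic_unitmx| | |]; rewrite ?r0 ?r1 ?r2 ?r3.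
Qed.

Lemma smooth_frame (R : realType) (J : set R) (J_open : open J)
    (e0 e1 e2 e3 : R -> 'rV[R]_4) :
  smooth_on J e0 -> smooth_on J e1 -> smooth_on J e2 -> smooth_on J e3 ->
  smooth_on J (fun t => frame (e0 t) (e1 t) (e2 t) (e3 t)).
Proof.
move=> /(smooth_mx J_open) e0J /(smooth_mx J_open) e1J /(smooth_mx J_open) e2J
  /(smooth_mx J_open) e3J; apply/smooth_mx => // -[[|[|[|[|//]]]] ilt] j.
- by apply: eq_smooth (e0J 0 j) => t; rewrite mxE.
- by apply: eq_smooth (e1J 0 j) => t; rewrite mxE.
- by apply: eq_smooth (e2J 0 j) => t; rewrite mxE.
- by apply: eq_smooth (e3J 0 j) => t; rewrite mxE.
Qed.

(** * Oriented planes and the fibres of piLam *)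

Lemma oplane_basis (R : realType) (v w v' w' : 'rV[R]_4) :
  oplane v' w' = oplane v w ->
  exists a b c d : R,
    [/\ 0 < a * d - b * c, v' = a *: v + b *: w & w' = c *: v + d *: w].
Proof.
move=> vw; have : oplane v' w' (v', w').
  exists 1, 0, 0, 1; split=> /=; first by rewrite mulr1 mulr0 subr0.
  - by rewrite scale1r scale0r addr0.
  - by rewrite scale1r scale0r add0r.
by rewrite vw.
Qed.

(** Along a curve in the fibre through E the first two vectors stay in the
    Lagrangian plane of E, which is a fixed linear subspace; so do their
    derivatives, and Lam vanishes between them and the rows of E. *)
Lemma vertical_eta (R : realType) (E Xi : 'M[R]_4) :
  vertical E Xi -> eta 0 0 E Xi = 0 /\ eta 1 1 E Xi = 0.
Proof.
move=> [J [c [J_open J0 [cJ cE] c0 <-]]].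
have E01 : Lam (row 0 E) (row 1 E) = 0.
  by have [[_ _ [+ _] _] _] := cE _ J0; rewrite c0.
have dc0 : derivable c 0 1 := cJ 0%N _ J0.
have Lam0 (i j : 'I_4) :
    (forall s, J s -> Lam (row i E) (row j (c s)) = 0) ->
    Lam (row i E) (row j (derive1 c 0)) = 0.
  move=> ij0; have := Lam_eq0_derive1 J_open (@smooth_cst R _ J (row i E))
    (smooth_row J_open (i := j) cJ) ij0 J0.
  rewrite derive1_cst Lam0l derive1_row// => /esym/eqP.
  by rewrite oppr_eq0 => /eqP.
by split; apply: Lam0 => s Js; have [_ /oplane_basis] := cE s Js;
  move=> [a [b [c' [d [_ cs0 cs1]]]]];
  rewrite ?cs0 ?cs1 Lam_combr Lamxx ?(LamC (row 1 E)) ?E01 ?oppr0 !mulr0 addr0.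
Qed.

(** * The osculating curve of a Lagrangian curve *)

Section OsculatingPlane.
Context {R : realType} {I : set R} {gamma : R -> 'rV[R]_4}.
Context (I_open : open I) (gamma_lagrangian : lagrangian_curve I gamma).

Let lambda t := Lam (derive1n 2 gamma t) (derive1n 3 gamma t).

Let smooth_gamma k : smooth_on I (derive1n k gamma).
Proof.
elim: k => [|k IHk]; first exact: gamma_lagrangian.1.
exact: smooth_derive1 IHk.
Qed.
Arguments smooth_gamma : clear implicits.

Lemma Lam_derive12 t : I t -> Lam (derive1 gamma t) (derive1n 2 gamma t) = 0.
Proof. by move=> It; have [] := gamma_lagrangian.2 t It. Qed.

Lemma Lam_derive13 t : I t -> Lam (derive1 gamma t) (derive1n 3 gamma t) = 0.
Proof.
move=> It; have := Lam_eq0_derive1 I_open (smooth_gamma 1%N) (smooth_gamma 2%N)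
  Lam_derive12 It.
by rewrite Lamxx => /esym/eqP; rewrite oppr_eq0 => /eqP.
Qed.

Lemma Lam_derive14 t : I t ->
  Lam (derive1 gamma t) (derive1n 4 gamma t) = - lambda t.
Proof.
move=> It; have := Lam_eq0_derive1 I_open (smooth_gamma 1%N) (smooth_gamma 3%N)
  Lam_derive13 It.
by rewrite /lambda => ->; rewrite opprK.
Qed.

Lemma osculating_lift : nondegenerate_curve I gamma ->
  exists E, lift_on I (osculating gamma) E.
Proof.
move=> l0.
pose e3 t := (lambda t)^-1 *: derive1n 3 gamma t.
pose e2 t := - (lambda t)^-1 *: derive1n 4 gamma t
  + Lam (derive1n 2 gamma t) (derive1n 4 gamma t)
      * ((lambda t)^-1 * (lambda t)^-1) *: derive1n 3 gamma t
  + Lam (derive1n 4 gamma t) (derive1n 3 gamma t)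
      * ((lambda t)^-1 * (lambda t)^-1) *: derive1n 2 gamma t.
have smooth_Lamg i j := smooth_Lam I_open (smooth_gamma i) (smooth_gamma j).
have lV := smoothV I_open l0 (smooth_Lamg 2%N 3%N).
have lVV := smoothM I_open lV lV.
have e3I : smooth_on I e3 := smoothZ I_open lV (smooth_gamma 3%N).
have e2I : smooth_on I e2 := smoothD I_open (smoothD I_open
  (smoothZ I_open (smoothN I_open lV) (smooth_gamma 4%N))
  (smoothZ I_open (smoothM I_open (smooth_Lamg 2%N 4%N) lVV)
    (smooth_gamma 3%N)))
  (smoothZ I_open (smoothM I_open (smooth_Lamg 4%N 3%N) lVV)
    (smooth_gamma 2%N)).
exists (fun t => frame (derive1 gamma t) (derive1n 2 gamma t) (e2 t) (e3 t)).
split.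
  exact (smooth_frame I_open (smooth_gamma 1%N) (smooth_gamma 2%N) e2I e3I).
move=> t It; split; last by rewrite /piLam !rowK.
exact (Sp4_osculating_frame (Lam_derive12 It) (Lam_derive13 It)
  (Lam_derive14 It) (l0 t It)).
Qed.

(** A curve Y in the osculating planes has its derivative Lam-orthogonal to g1,
    and its product with g2 sees only the component of Y along g2: the
    coefficients of Y on g1 and g2 are used at the single time t, never
    differentiated. *)
Lemma derive1_in_osculating (J : set R) (Y : R -> 'rV[R]_4) t a b a' b' :
  open J -> J `<=` I -> smooth_on J Y ->
  (forall s, J s -> exists a b : R,
    Y s = a *: derive1 gamma s + b *: derive1n 2 gamma s) ->
  J t -> Y t = a *: derive1 gamma t + b *: derive1n 2 gamma t ->
  Lam (a' *: derive1 gamma t + b' *: derive1n 2 gamma t) (derive1 Y t) =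
  b' * b * lambda t.
Proof.
move=> J_open JI YJ Yspan Jt Yt.
have smoothJ k : smooth_on J (derive1n k gamma).
  by move=> n s /JI; exact: smooth_gamma.
have Y1 s : J s -> Lam (derive1 gamma s) (Y s) = 0.
  move=> Js; have [c [d ->]] := Yspan s Js.
  by rewrite Lam_combr Lamxx (Lam_derive12 (JI _ Js)) !mulr0 addr0.
have Y2 s : J s -> Lam (derive1n 2 gamma s) (Y s) = 0.
  move=> Js; have [c [d ->]] := Yspan s Js.
  rewrite Lam_combr Lamxx LamC.
  by rewrite (Lam_derive12 (JI _ Js)) oppr0 !mulr0 addr0.
have dY1 : Lam (derive1 gamma t) (derive1 Y t) = 0.
  have := Lam_eq0_derive1 J_open (smoothJ 1%N) YJ Y1 Jt.
  by rewrite [LHS](Y2 t Jt) => /esym/eqP; rewrite oppr_eq0 => /eqP.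
have dY2 : Lam (derive1n 2 gamma t) (derive1 Y t) = b * lambda t.
  have L31 : Lam (derive1n 3 gamma t) (derive1 gamma t) = 0.
    by rewrite LamC (Lam_derive13 (JI _ Jt)) oppr0.
  have L32 : Lam (derive1n 3 gamma t) (derive1n 2 gamma t) = - lambda t.
    exact: LamC.
  have L3Y : Lam (derive1n 3 gamma t) (Y t) = - (b * lambda t).
    by rewrite Yt Lam_combr L31 L32 mulr0 add0r mulrN.
  apply: oppr_inj; rewrite -L3Y; apply: esym.
  exact (Lam_eq0_derive1 J_open (smoothJ 2%N) YJ Y2 Jt).
rewrite LamC Lam_combr (LamC _ (derive1 gamma t)) dY1.
rewrite (LamC _ (derive1n 2 gamma t)) dY2.
by rewrite oppr0 mulr0 add0r mulrN opprK mulrA.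
Qed.

(** The coefficients b0 and b1 are the components along the second derivative of
    gamma of the first two vectors of the lift. *)
Lemma osculating_eta (J : set R) (E : R -> 'M[R]_4) t :
  open J -> J `<=` I -> lift_on J (osculating gamma) E -> J t ->
  exists b0 b1 : R,
    [/\ (b0 != 0) || (b1 != 0),
        eta 0 0 (E t) (derive1 E t) = b0 * b0 * lambda t,
        eta 1 1 (E t) (derive1 E t) = b1 * b1 * lambda t
      & eta 1 0 (E t) (derive1 E t) = b1 * b0 * lambda t].
Proof.
move=> J_open JI [EJ Eosc] Jt.
have basis s (Js : J s) := oplane_basis (Eosc s Js).2.
have span0 s : J s -> exists a b : R,
    row 0 (E s) = a *: derive1 gamma s + b *: derive1n 2 gamma s.
  by move=> /basis[a [b [c [d [_ Es _]]]]]; exists a, b.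
have span1 s : J s -> exists a b : R,
    row 1 (E s) = a *: derive1 gamma s + b *: derive1n 2 gamma s.
  by move=> /basis[a [b [c [d [_ _ Es]]]]]; exists c, d.
have [a0 [b0 [a1 [b1 [detP E0 E1]]]]] := basis t Jt.
have dE : derivable E t 1 := EJ 0%N _ Jt.
have smoothE i := smooth_row J_open (i := i) EJ.
exists b0, b1; split.
- apply: contraTT detP; rewrite negb_or !negbK => /andP[/eqP-> /eqP->].
  by rewrite mulr0 mul0r subrr ltxx.
- rewrite /eta -derive1_row// {1}E0.
  exact: (derive1_in_osculating _ _ J_open JI (smoothE 0) span0 Jt E0).
- rewrite /eta -derive1_row// {1}E1.
  exact: (derive1_in_osculating _ _ J_open JI (smoothE 1) span1 Jt E1).
- rewrite /eta -derive1_row// {1}E1.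
  exact: (derive1_in_osculating _ _ J_open JI (smoothE 0) span0 Jt E0).
Qed.

End OsculatingPlane.

Theorem proposition2p9 (R : realType) (I : set R) (gamma : R -> 'rV[R]_4)
    (I_open : open I) (I_interval : is_interval I)
    (gamma_lagrangian : lagrangian_curve I gamma)
    (gamma_nondegenerate : nondegenerate_curve I gamma) :
  null_curve I (osculating gamma).
Proof.
split.
- split=> t It.
    have [gfree gLam] := gamma_lagrangian.2 t It.
    by exists (derive1 gamma t), (derive1n 2 gamma t).
  have [E EI] := osculating_lift I_open gamma_lagrangian gamma_nondegenerate.
  by exists I, E; split.
- move=> J E J_open JI EJ t Jt /vertical_eta.
  have [b0 [b1 [b_neq0 -> -> _]]] :=
    osculating_eta I_open gamma_lagrangian J_open JI EJ Jt.
  have /negPf l0 := gamma_nondegenerate t (JI t Jt).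
  move=> [/eqP + /eqP]; rewrite !mulf_eq0 l0 !orbF !orbb => b00 b10.
  by move: b_neq0; rewrite b00 b10.
- move=> J E J_open JI EJ t Jt; rewrite /gconf.
  have [b0 [b1 [_ -> -> ->]]] :=
    osculating_eta I_open gamma_lagrangian J_open JI EJ Jt.
  ring.
Qed.
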